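(* Let $X$ be a real normed space and let one of the two following conditions hold true: 1. $\varphi$ is uniformly continuous on the set $\{x \in X \mid \operatorname{dist}(x,\Omega) < \delta\}$ for some $\delta > 0$; 2. $\varphi$ is uniformly continuous on bounded sets and one of the following three conditions is satisfied: (a) the set $\Omega$ is bounded, (b) there exists a nondecreasing function $\eta \colon [0,+\infty) \to [0,+\infty)$ such that $f(x) + \eta(\operatorname{dist}(x,\Omega)) \to +\infty$ as $\|x\| \to +\infty$, (c) the set $\{x \in X \mid |f(x) - f_*| < \alpha, \ \operatorname{dist}(x,\Omega) < \delta\}$ is bounded for some $\alpha > 0$ and $\delta > 0$. Then for the problem $(\mathcal{P})$: minimize $f(x)$ subject to $x \in M$, $x \in Q$, to be weakly Levitin-Polyak well-posed in the extended sense it is sufficient that this problem is weakly Levitin-Polyak well-posed with respect to the infeasibility measure $\varphi$.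
   Context: $M,Q \subset X$ are nonempty, $f \colon X \to \mathbb{R}\cup\{+\infty\}$. The feasible region $\Omega = M \cap Q$ is nonempty and the optimal value $f_* = \inf_{x\in\Omega} f(x)$ is finite; $\operatorname{argmin}(\mathcal{P})$ is the (possibly empty) set of globally optimal solutions of $(\mathcal{P})$. $\operatorname{dist}(x,V) = \inf_{y \in V} \|x-y\|$. An infeasibility measure for the constraint $x \in M$ on $Q$ is a function $\varphi \colon X \to [0,+\infty]$ such that for any $x \in Q$ one has $\varphi(x)=0 \iff x \in M$; such a $\varphi$ is fixed. Uniform continuity of $\varphi$ on a set includes its finiteness on that set. $(\mathcal{P})$ is weakly Levitin-Polyak well-posed in the extended sense if $\operatorname{argmin}(\mathcal{P}) \ne \emptyset$ and for any sequence $\{x_n\} \subset X$ such that $f(x_n) \to f_*$ and $\operatorname{dist}(x_n,\Omega) \to 0$ one has $\operatorname{dist}(x_n, \operatorname{argmin}(\mathcal{P})) \to 0$. $(\mathcal{P})$ is weakly Levitin-Polyak well-posed with respect to $\varphi$ if $\operatorname{argmin}(\mathcal{P}) \ne \emptyset$ and for any sequence $\{x_n\} \subset X$ such that $f(x_n) \to f_*$ and $\varphi(x_n) \to 0$ one has $\operatorname{dist}(x_n, \operatorname{argmin}(\mathcal{P})) \to 0$. *)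

(* Defs.v *)
From mathcomp Require Import all_boot all_order all_algebra.
From mathcomp Require Import all_classical all_reals all_analysis.

Set Implicit Arguments.
Unset Strict Implicit.
Unset Printing Implicit Defensive.

Import Order.TTheory GRing.Theory Num.Theory.
Import numFieldNormedType.Exports.

Local Open Scope classical_set_scope.
Local Open Scope ring_scope.

Section Definitions.
Context {R : realType} {X : normedModType R}.
Implicit Types (M Q V A : set X) (f phi : X -> \bar R) (x : X).

(* Only meaningful for nonempty V: the real infimum of the empty set is 0. *)
Definition dist x V : R := inf [set `|x - y| | y in V].

Definition feasible M Q : set X := M `&` Q.

Definition optval f M Q : \bar R := ereal_inf (f @` feasible M Q).

Definition argmin f M Q : set X :=
  [set x | feasible M Q x /\ forall y, feasible M Q y -> (f x <= f y)%E].

Definition infeasibility_measure M Q phi : Prop :=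
  (forall x, (0 <= phi x)%E) /\ (forall x, Q x -> (phi x = 0%E <-> M x)).

(* phi is required to be finite on A, and its real values to be uniformly
   continuous for the usual distance of R; the uniform structure of \bar R,
   which is that of a bounded interval, is not the intended one. *)
Definition uniformly_continuous_on A phi : Prop :=
  (forall x, A x -> phi x \is a fin_num) /\
  (forall e : R, 0 < e -> exists2 d : R, 0 < d &
     forall x y, A x -> A y -> `|x - y| < d ->
       `|fine (phi x) - fine (phi y)| < e).

(* g x --> +oo as `|x| --> +oo *)
Definition coercive (g : X -> \bar R) : Prop :=
  forall a : R, exists r : R, forall x, r < `|x| -> (a%:E < g x)%E.

Definition weakly_LP_wellposed_extended f M Q : Prop :=
  argmin f M Q !=set0 /\
  forall u : nat -> X,
    f (u n) @[n --> \oo] --> optval f M Q ->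
    dist (u n) (feasible M Q) @[n --> \oo] --> (0 : R) ->
    dist (u n) (argmin f M Q) @[n --> \oo] --> (0 : R).

Definition weakly_LP_wellposed_wrt phi f M Q : Prop :=
  argmin f M Q !=set0 /\
  forall u : nat -> X,
    f (u n) @[n --> \oo] --> optval f M Q ->
    phi (u n) @[n --> \oo] --> (0%E : \bar R) ->
    dist (u n) (argmin f M Q) @[n --> \oo] --> (0 : R).

End Definitions.

(* Main.v *)
Require Import Defs.
From mathcomp Require Import all_boot all_order all_algebra.
From mathcomp Require Import all_classical all_reals all_analysis.
From mathcomp Require Import lra.

Import Order.TTheory GRing.Theory Num.Theory.
Import numFieldNormedType.Exports.

Local Open Scope classical_set_scope.
Local Open Scope ring_scope.

(** The measure [phi] vanishes on the feasible set, and points close to the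
    feasible set have feasible points close to them. Hence, if [phi] is uniformly
    continuous on a set that eventually contains both [u n] and its nearby
    feasible points, then [phi (u n) --> 0], and well-posedness with respect to
    [phi] applies to [u]. Under the second group of hypotheses this set is a
    ball, since each of (a), (b), (c) forces [u] to be eventually bounded. *)

Section Distance.
Context {R : realType} {X : normedModType R}.
Implicit Types (V : set X) (x y : X).

Lemma dist_lt_ex V x (e : R) :
  V !=set0 -> dist x V < e -> exists2 y, V y & `|x - y| < e.
Proof.
move=> [v Vv] xe.
have [|_ [y Vy <-] ye] := inf_lt _ xe.
- by exists `|x - v|, v.
- by exists y.
Qed.

Lemma dist_ge0 V x : V !=set0 -> 0 <= dist x V.
Proof.
move=> [v Vv]; apply: lb_le_inf; first by exists `|x - v|, v.
by move=> _ [y _ <-].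
Qed.

Lemma dist_mem_le0 V x : V x -> dist x V <= 0.
Proof.
move=> Vx; apply: ge_inf; first by exists 0 => _ [y _ <-].
by exists x => //; rewrite subrr normr0.
Qed.

Lemma bounded_set_ler V :
  bounded_set V -> exists r : R, forall x, V x -> `|x| <= r.
(* The bound supplied by [bounded_set] is only valid for reals strictly above [r], hence [r + 1]. *)
Proof. by move=> [r [_ Vr]]; exists (r + 1) => x; apply: Vr; rewrite ltrDl. Qed.

Lemma bounded_set_closed_ball (r : R) : bounded_set [set x : X | `|x| <= r].
Proof.
exists r; split=> [|s rs x /= xr]; first exact: num_real.
exact: le_trans xr (ltW rs).
Qed.

End Distance.

Section LevitinPolyak.
Context {R : realType} {X : normedModType R}.
Variables (M Q : set X) (f phi : X -> \bar R).
Hypothesis Omega_neq0 : feasible M Q !=set0.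
Hypothesis phi_infeas : infeasibility_measure M Q phi.
Variable u : nat -> X.
Hypothesis u_dist : dist (u n) (feasible M Q) @[n --> \oo] --> (0 : R).

Lemma near_dist_lt (e : R) :
  0 < e -> \forall n \near \oo, dist (u n) (feasible M Q) < e.
Proof. by move=> e0; apply: (cvgr_lt _ u_dist). Qed.

Lemma phi_feasible x : feasible M Q x -> phi x = 0%E.
Proof. by case: phi_infeas => _ phiM [Mx Qx]; apply/phiM. Qed.

(** A feasible [y] near [u n] has [phi y = 0], so the modulus of continuity bounds [phi (u n)]
    itself. Asking [A] to contain only the feasible points within [delta] of [u n] lets [A] be a
    ball even when the feasible set is unbounded. *)
Lemma uniformly_continuous_on_cvg0 (A : set X) (delta : R) :
  uniformly_continuous_on A phi -> 0 < delta ->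
  (\forall n \near \oo, A (u n) /\
     forall y, feasible M Q y -> `|u n - y| < delta -> A y) ->
  phi (u n) @[n --> \oo] --> (0%E : \bar R).
Proof.
move=> [Afin Auc] delta0 uA; apply/fine_cvgP; split.
  by apply: filterS uA => n [/Afin].
apply/cvgr0Pnorm_lt => e e0; have [d d0 dP] := Auc _ e0.
(* Closeness [d] is for the modulus of continuity, closeness [delta] puts the feasible point in
   [A]. *)
have de0 : 0 < Num.min d delta by rewrite lt_min d0.
apply: filterS2 uA (near_dist_lt _ de0) => n [Aun Ay].
move=> /(dist_lt_ex _ _ _ Omega_neq0)[y Oy] /=.
rewrite lt_min => /andP[yd ydelta].
have := dP _ _ Aun (Ay _ Oy ydelta) yd.
by rewrite (phi_feasible _ Oy) /= subr0.
Qed.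

Lemma bounded_uniformly_continuous_cvg0 (r : R) :
  (forall A : set X, bounded_set A -> uniformly_continuous_on A phi) ->
  (\forall n \near \oo, `|u n| <= r) ->
  phi (u n) @[n --> \oo] --> (0%E : \bar R).
Proof.
move=> uc ur; have ucb := uc _ (bounded_set_closed_ball (r + 1)).
apply: (uniformly_continuous_on_cvg0 _ _ ucb ltr01).
apply: filterS ur => n unr /=; split=> [|y _ uny]; first by lra.
have := ler_distD (u n) 0 y; rewrite !sub0r !normrN; lra.
Qed.

Lemma near_norm_le_bounded :
  bounded_set (feasible M Q) -> exists r : R, \forall n \near \oo, `|u n| <= r.
Proof.
move=> /bounded_set_ler[r Or]; exists (r + 1).
apply: filterS (near_dist_lt _ ltr01) => n.
move=> /(dist_lt_ex _ _ _ Omega_neq0)[y /Or yr uny].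
have := ler_distD y 0 (u n); rewrite !sub0r !normrN (distrC y); lra.
Qed.

Hypothesis optval_fin : optval f M Q \is a fin_num.
Hypothesis u_f : f (u n) @[n --> \oo] --> optval f M Q.

Lemma near_optval_dist (e : R) : 0 < e ->
  \forall n \near \oo, (`|f (u n) - optval f M Q| < e%:E)%E.
Proof.
move=> e0; move: u_f optval_fin; case: (optval f M Q) => // c + _.
move=> /fine_cvgP[ffin fc].
(* Once [f (u n)] is finite, the extended distance to [c] is the real one. *)
by apply: filterS2 ffin (cvgr_distC_lt _ _ fc _ e0) => n /=; case: (f (u n)).
Qed.

(** Eventually [f (u n)] is less than 1 above the optimal value and the distance to the feasible set
    is below 1, so monotonicity caps the [eta] term by [eta 1]. The coercive function thus stays
    below a constant along [u], which rules out large norms. *)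
Lemma near_norm_le_coercive (eta : R -> R) :
  (forall s t : R, 0 <= s -> s <= t -> eta s <= eta t) ->
  coercive (fun x : X => f x + (eta (dist x (feasible M Q)))%:E)%E ->
  exists r : R, \forall n \near \oo, `|u n| <= r.
Proof.
move=> eta_nd /(_ (fine (optval f M Q) + 1 + eta 1))[r rP]; exists r.
apply: filterS2 (near_optval_dist _ ltr01) (near_dist_lt _ ltr01) => n fn dn.
rewrite leNgt; apply/negP => /rP.
have := eta_nd _ _ (dist_ge0 _ (u n) Omega_neq0) (ltW dn).
move: fn optval_fin; case: (optval f M Q) => // c; case: (f (u n)) => //= a.
by rewrite !lte_fin ltr_norml => /andP[_ ac] _; lra.
Qed.

Lemma near_norm_le_sublevel (alpha delta : R) : 0 < alpha -> 0 < delta ->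
  bounded_set [set x : X | (`|f x - optval f M Q| < alpha%:E)%E /\
                           dist x (feasible M Q) < delta] ->
  exists r : R, \forall n \near \oo, `|u n| <= r.
Proof.
move=> alpha0 delta0 /bounded_set_ler[r rP]; exists r.
have fu := near_optval_dist _ alpha0.
by apply: filterS2 fu (near_dist_lt _ delta0) => n fn dn; apply: rP.
Qed.

End LevitinPolyak.

Theorem proposition8 (R : realType) (X : normedModType R) (M Q : set X)
  (f phi : X -> \bar R)
  (M_neq0 : M !=set0) (Q_neq0 : Q !=set0)
  (f_neqNy : forall x : X, f x != -oo%E)
  (feasible_neq0 : feasible M Q !=set0)
  (optval_fin : optval f M Q \is a fin_num)
  (phi_infeas : infeasibility_measure M Q phi)
  (hyp :
    (exists2 delta : R, 0 < delta &
       uniformly_continuous_on [set x : X | dist x (feasible M Q) < delta] phi)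
    \/
    ((forall A : set X, bounded_set A -> uniformly_continuous_on A phi) /\
     [\/ bounded_set (feasible M Q),
         (exists eta : R -> R,
            [/\ (forall t : R, 0 <= t -> 0 <= eta t),
                (forall s t : R, 0 <= s -> s <= t -> eta s <= eta t) &
                coercive (fun x : X => f x + (eta (dist x (feasible M Q)))%:E)%E]) |
         (exists alpha delta : R,
            [/\ 0 < alpha, 0 < delta &
                bounded_set [set x : X | (`|f x - optval f M Q| < alpha%:E)%E /\
                                         dist x (feasible M Q) < delta]])])) :
  weakly_LP_wellposed_wrt phi f M Q -> weakly_LP_wellposed_extended f M Q.
Proof.
move=> [argmin_neq0 wp]; split=> // u uf ud; apply: wp => //.
case: hyp => [[delta delta0 uc]|[uc cond]].
  (* Every feasible point lies in the tube, whatever its distance to [u n]; the radius 1 is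
     arbitrary. *)
  apply: (uniformly_continuous_on_cvg0 _ _ _ feasible_neq0 phi_infeas _ ud
    _ _ uc ltr01).
  apply: filterS (near_dist_lt _ _ _ ud _ delta0) => n un; split=> // y Oy _ /=.
  exact: le_lt_trans (dist_mem_le0 _ _ Oy) delta0.
suff [r ur] : exists r : R, \forall n \near \oo, `|u n| <= r.
  exact: (bounded_uniformly_continuous_cvg0 _ _ _ feasible_neq0 phi_infeas
    _ ud r).
case: cond => [bO|[eta [_ eta_nd eta_co]]|[alpha [delta [alpha0 delta0 bS]]]].
- exact: near_norm_le_bounded bO.
- exact: near_norm_le_coercive eta_co.
- exact: near_norm_le_sublevel bS.
Qed.
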